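(* $\vec\chi(Forb_{ind}(\overleftrightarrow{K_2}, K_4, P^+(3)))\le 414$; that is, every oriented graph whose underlying graph is $K_4$-free and which has no induced directed path with $3$ arcs has dichromatic number at most $414$.
   Context: Digraphs have no loops and no parallel arcs, but both $xy$ and $yx$ may be arcs. The dichromatic number $\vec\chi(D)$ is the minimum number of colors in a vertex coloring in which no color class induces a directed cycle; $\vec\chi(\mathcal C)=\sup_{D\in\mathcal C}\vec\chi(D)$. For a set $\mathcal F$ of digraphs and undirected graphs, $Forb_{ind}(\mathcal F)$ is the class of digraphs containing as an induced subdigraph neither a digraph in $\mathcal F$ nor any orientation of an undirected graph in $\mathcal F$. $\overleftrightarrow{K_2}$ is the digon; $K_4$ is the undirected complete graph on $4$ vertices; $P^+(3)$ is the directed path with $3$ arcs. *)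

(* Defs.v *)
From mathcomp Require Import all_boot.
Set Implicit Arguments.
Unset Strict Implicit.
Unset Printing Implicit Defensive.

(* Finite, loopless, no parallel arcs; both [arc x y] and [arc y x] may hold. *)
Record digraph := Digraph {
  vertex :> finType;
  arc : rel vertex;
  arc_irr : irreflexive arc }.

Record sgraph := SGraph {
  svertex :> finType;
  edge : rel svertex;
  edge_sym : symmetric edge;
  edge_irr : irreflexive edge }.

(* Length-2 dicycles (digons) count as directed cycles. *)
Definition dicycle (D : digraph) (c : seq D) : bool :=
  (1 < size c) && ucycleb (@arc D) c.

(* A dicycle has at most #|D| vertices, so the bound on the length is only
   there to make the predicate decidable; see [acyclicP]. *)
Definition acyclic (D : digraph) (A : {set D}) : bool :=
  [forall n : 'I_#|D|.+1, forall c : n.-tuple D,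
     dicycle c ==> ~~ all [in A] c].

Lemma acyclicP (D : digraph) (A : {set D}) :
  reflect (forall c : seq D, dicycle c -> ~ {subset c <= A}) (acyclic A).
Proof.
apply: (iffP forallP) => [acA c dc sAc | acA n].
  have ltc : size c < #|D|.+1.
    by case/and3P: dc => _ _ /card_uniqP <-; rewrite ltnS max_card.
  have /forallP/(_ (in_tuple c))/implyP/(_ dc)/negP := acA (Ordinal ltc).
  by apply; apply/allP.
apply/forallP=> c; apply/implyP=> dc; apply/negP=> /allP sAc.
exact: acA dc sAc.
Qed.

Definition dicoloring (D : digraph) (k : nat) (col : {ffun D -> 'I_k}) : bool :=
  [forall i : 'I_k, acyclic [set x | col x == i]].

Definition dicolorable (D : digraph) (k : nat) : bool :=
  [exists col : {ffun D -> 'I_k}, dicoloring col].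

Lemma dicolorable_card (D : digraph) : exists k, dicolorable D k.
Proof.
exists #|D|; apply/existsP; exists [ffun x => enum_rank x].
apply/forallP=> i; apply/acyclicP=> [[|x [|y c]]] // /and3P[_ _ /andP[xNyc _]].
move=> sub; have := sub x; have := sub y.
rewrite !inE !eqxx orbT !ffunE => /(_ isT)/eqP yi /(_ isT)/eqP xi.
by move: xNyc; rewrite (enum_rank_inj (etrans xi (esym yi))) inE eqxx.
Qed.

Definition dichromatic (D : digraph) : nat := ex_minn (dicolorable_card D).

Definition induced_in (V : finType) (r : rel V) (D : digraph) : Prop :=
  exists2 f : V -> D, injective f & forall x y, arc (f x) (f y) = r x y.

Definition orientation (G : sgraph) (r : rel G) : Prop :=
  (forall x y, ~~ (r x y && r y x)) /\
  (forall x y, edge x y = r x y || r y x).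

Definition excludes (D : digraph) (H : digraph + sgraph) : Prop :=
  match H with
  | inl H => ~ induced_in (@arc H) D
  | inr G => forall r : rel G, orientation r -> ~ induced_in r D
  end.

Definition Forb_ind (F : digraph + sgraph -> Prop) (D : digraph) : Prop :=
  forall H, F H -> excludes D H.

Lemma neq_irr (T : eqType) : irreflexive (fun x y : T => x != y).
Proof. by move=> x; rewrite eqxx. Qed.

Lemma neq_sym (T : eqType) : symmetric (fun x y : T => x != y).
Proof. by move=> x y; rewrite eq_sym. Qed.

Definition digon : digraph := Digraph (@neq_irr 'I_2).

Definition complete (n : nat) : sgraph :=
  SGraph (@neq_sym 'I_n) (@neq_irr 'I_n).

Lemma succ_irr (n : nat) : irreflexive (fun i j : 'I_n => j == i.+1 :> nat).
Proof. by move=> i; rewrite ltn_eqF. Qed.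

(* Directed path with n arcs, hence n.+1 vertices. *)
Definition dipath (n : nat) : digraph := Digraph (@succ_irr n.+1).

(* Main.v *)
(** Call [Q] dipolar in [S] if no vertex of [Q] has both an in-neighbour and an
    out-neighbour in [S] outside [Q]; if [Q] is [k]-colorable and the rest of [S]
    is [2k]-colorable then so is [S].  Suppose that all neighbourhoods in [S] are
    [s]-colorable.  If [S] has a directed triangle, its neighbourhood, together
    with the neighbourhoods of the vertices that can replace one of its three
    vertices, is dipolar and [9s]-colorable.  Otherwise a directed cycle of [S]
    yields a directed 4-cycle through some [a], whose neighbourhood together with
    the second out- and in-neighbourhoods of [a] is dipolar and
    [6s]-colorable.  Hence [S] is [18s]-colorable.  By K4-freeness the common
    neighbourhood of two adjacent vertices is stable, so every neighbourhood is
    18-colorable and the whole digraph is 324-colorable. *)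

From mathcomp Require Import all_boot zify.
Require Import Defs.
Set Implicit Arguments.
Unset Strict Implicit.
Unset Printing Implicit Defensive.

(** * Closed walks and colorings without monochromatic directed cycles *)

Section Coloring.
Variable D : digraph.
Implicit Types A B Q S : {set D}.

Definition adj (x y : D) : bool := arc x y || arc y x.

Definition nbr (x : D) : {set D} := [set y | adj x y].

Lemma adjC x y : adj x y = adj y x.
Proof. by rewrite /adj orbC. Qed.

Lemma arc_adj x y : arc x y -> adj x y.
Proof. by rewrite /adj => ->. Qed.

(** The sequence [c] may repeat vertices. A closed walk contains a directed cycle, so this is still
    acyclicity, with no uniqueness condition to maintain. *)
Definition cycle_free (A : {set D}) : Prop :=
  forall c : seq D, cycle (@arc D) c -> c != [::] -> ~ {subset c <= A}.

Definition colorable (S : {set D}) (k : nat) : Prop :=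
  exists f : D -> nat, {in S, forall x, f x < k} /\
    forall i, cycle_free [set x in S | f x == i].

(** Rotated to start at [x], the cycle is a path through all vertices of [c], and [P] is handed on
    along it. *)
Lemma cycle_ind (P : pred D) (c : seq D) :
    cycle (@arc D) c -> {in c &, forall x y, arc x y -> P x -> P y} ->
  {in c &, forall x y, P x -> P y}.
Proof.
move=> cc stepP x y xc yc Px.
have [i l def_c] := rot_to xc.
have memE : rot i c =i c by move=> z; rewrite mem_rot.
move: cc; rewrite -(rot_cycle i) def_c /= rcons_path => /andP[pl _].
have {}stepP : {in x :: l &, forall u v, arc u v -> P u -> P v}.
  by move=> u v; rewrite -def_c !memE; apply: stepP.
move: yc; rewrite -memE def_c => {def_c memE i xc}.
elim: l x pl Px stepP => [|z l IHl] x /=; first by rewrite inE => _ Px _ /eqP->.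
case/andP=> xz pl Px stepP; rewrite inE => /orP[/eqP->//|].
apply: IHl => //.
  by apply: stepP Px => //; rewrite !inE eqxx ?orbT.
by move=> u v uz vz; apply: stepP; rewrite inE (uz, vz) orbT.
Qed.

Lemma cycle_const (m : D -> nat) (c : seq D) :
    cycle (@arc D) c ->
    {in c &, forall x y, arc x y -> m y <= m x} \/
    {in c &, forall x y, arc x y -> m x <= m y} ->
  {in c &, forall x y, m x = m y}.
Proof.
move=> cc mono x y xc yc; wlog suff le_m : x y xc yc / m y <= m x.
  by apply/eqP; rewrite eqn_leq !le_m.
case: mono => mono.
  apply: (cycle_ind (P := fun z => m z <= m x) cc _ xc yc) => //.
  by move=> u v uc vc uv; apply: leq_trans; apply: mono.
apply: (cycle_ind (P := fun z => m y <= m z) cc _ yc xc) => //.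
by move=> u v uc vc uv le_yu; apply: leq_trans le_yu (mono _ _ uc vc uv).
Qed.

Lemma cycle_freeS A B : A \subset B -> cycle_free B -> cycle_free A.
Proof.
by move=> /subsetP sAB cfB c cc c0 scA; apply: (cfB c cc c0) => x /scA/sAB.
Qed.

Lemma stable_cycle_free A :
  {in A &, forall x y, ~~ arc x y} -> cycle_free A.
Proof.
move=> stA [//|x c] /= cc _ scA.
have [y yc xy] : exists2 y, y \in x :: c & arc x y.
  case: c cc {scA} => [|y c] /= /andP[xy _]; exists y || exists x => //.
    exact: mem_head.
  by rewrite !inE eqxx orbT.
by have := stA x y (scA _ (mem_head _ _)) (scA _ yc); rewrite xy.
Qed.

Lemma colorable_cycle_free A k : 0 < k -> cycle_free A -> colorable A k.
Proof.
move=> k0 cfA; exists (fun=> 0); split=> // i.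
by apply: cycle_freeS cfA; apply/subsetP=> x; rewrite inE => /andP[].
Qed.

Lemma colorableS A B k l :
  A \subset B -> k <= l -> colorable B k -> colorable A l.
Proof.
move=> sAB le_kl [f [ltf cff]]; exists f; split=> [x /(subsetP sAB)/ltf|i].
  by move/leq_trans; apply.
by apply: cycle_freeS (cff i); apply/subsetP=> x; rewrite !inE
   => /andP[/(subsetP sAB)-> ->].
Qed.

Lemma colorableU A B k l :
  colorable A k -> colorable B l -> colorable (A :|: B) (k + l).
Proof.
move=> [f [ltf cff]] [g [ltg cfg]].
exists (fun x => if x \in A then f x else k + g x); split=> [x|i].
  by rewrite inE; case: ifP => [/ltf|_ /ltg]; lia.
have [lt_ik|le_ki] := ltnP i k.
  apply: cycle_freeS (cff i); apply/subsetP=> x; rewrite !inE.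
  by case: ifP => //= _ /andP[_ /eqP]; lia.
apply: cycle_freeS (cfg (i - k)); apply/subsetP=> x; rewrite !inE.
case: ifP => [/ltf|_ /=]; first by move=> lt_f /= /eqP; lia.
by case/andP=> -> /eqP; lia.
Qed.

(** * Dipolar sets *)

Definition dipolar (S Q : {set D}) : Prop :=
  {in Q, forall v, {in S :\: Q &, forall u w, ~~ (arc u v && arc v w)}}.

(* [Q] splits into a part that cannot be entered from [S :\: Q] and a part that
   cannot be left towards it; each of them gets half of the colors. *)
Lemma colorable_dipolar S Q k :
    dipolar S Q -> colorable Q k -> colorable (S :\: Q) k.*2 ->
  colorable S k.*2.
Proof.
move=> dipQ [g [ltg cfg]] [h [lth cfh]].
pose P := [set v | [forall (u | u \in S :\: Q), ~~ arc u v]].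
exists (fun x => if x \in Q then if x \in P then g x else k + g x else h x).
split=> [x xS|i c cc c0 sc].
  case: ifP => [/ltg|xQ]; first by case: ifP; lia.
  by apply: lth; rewrite inE xQ.
case: c cc c0 sc => // x c; set d := x :: c => cc _ sc.
have xd : x \in d by apply: mem_head.
have dS u : u \in d -> u \in S by move=> /sc; rewrite inE => /andP[].
have [/hasP[v vd vQ]|/hasPn NdQ] := boolP (has [in Q] d); last first.
  apply: (cfh i d cc) => // u ud; move: (sc _ ud) (NdQ _ ud).
  by rewrite !inE => /andP[uS fu] /negPf uQ; move: fu; rewrite uQ uS.
(* A cycle that meets [Q] without staying inside it both enters and leaves [Q]; colors below [k]
   forbid entering, the others forbid leaving. *)
have dQ : {subset d <= Q}.
  have [lt_ik|le_ki] := ltnP i k.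
    move=> u ud; apply: contraLR vQ => uQ.
    apply: (cycle_ind (P := [predC Q]) cc _ ud vd uQ) => y z yd zd yz /= yQ.
    apply/negP=> zQ; move: (sc _ zd); rewrite inE zQ => /andP[_].
    case: ifP => [|_ /eqP]; last by lia.
    rewrite inE => /forallP/(_ y); rewrite inE yQ (dS _ yd) /= yz.
    by [].
  move=> u ud.
  apply: (cycle_ind (P := [in Q]) cc _ vd ud vQ) => y z yd zd yz /= yQ.
  apply: contraT => zQ; move: (sc _ yd); rewrite inE yQ => /andP[_].
  case: ifP => [_ /eqP|yP _]; first by have := ltg _ yQ; lia.
  move/negbT: yP; rewrite inE negb_forall => /existsP[w].
  rewrite negb_imply negbK => /andP[wS wy].
  have := dipQ _ yQ w z wS; rewrite inE zQ (dS _ zd) wy yz.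
  by move/(_ isT).
have [lt_ik|le_ki] := ltnP i k.
  apply: (cfg i d cc) => // u ud; move: (sc _ ud).
  rewrite !inE (dQ _ ud) /= => /andP[_].
  by case: ifP => // _ /eqP; lia.
apply: (cfg (i - k) d cc) => // u ud; move: (sc _ ud).
rewrite !inE (dQ _ ud) /= => /andP[_].
by case: ifP => _ /eqP; have := ltg _ (dQ _ ud); lia.
Qed.

(** * Colorings from a rank that is monotone along arcs *)

(** By [cycle_const] every cycle stays in one fiber of [m], so all fibers can share the same [k]
    colors. *)
Lemma colorable_fibers A k (m : D -> nat) :
    {in A &, forall x y, arc x y -> m y <= m x} \/
    {in A &, forall x y, arc x y -> m x <= m y} ->
    (forall n, colorable [set x in A | m x == n] k) ->
  colorable A k.
Proof.
move=> mono fibs; pose N := \max_x m x.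
(* Bounding the rank by [N] leaves finitely many fibers, so that a coloring can be chosen for
   each. *)
have [f fP] := fin_all_exists (fun i : 'I_N.+1 => fibs i).
have mN x : m x = @inord N (m x).
  by rewrite inordK // ltnS /N (leq_bigmax x).
exists (fun x => f (inord (m x)) x); split=> [x xA|i c cc c0 sc].
  by case: (fP (inord (m x))) => -> //; rewrite inE xA -mN /=.
case: c cc c0 sc => // x c; set d := x :: c => cc _ sc.
have xd : x \in d by apply: mem_head.
have dA u : u \in d -> u \in A by move=> /sc; rewrite inE => /andP[].
have mE : {in d &, forall u v, m u = m v}.
  apply: cycle_const cc _.
  by case: mono => mono; [left|right] => u v /dA uA /dA vA; apply: mono.
have [_ /(_ i d cc)] := fP (inord (m x)); apply=> // u ud.
move: (sc _ ud); rewrite !inE (mE u x ud xd) => /andP[-> ->].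
by rewrite -mN eqxx.
Qed.

Definition first (T : {set D}) (r : rel D) (y : D) : D :=
  nth y (enum T) (find (r^~ y) (enum T)).

Lemma firstP (T : {set D}) (r : rel D) y :
  (exists2 x, x \in T & r x y) -> first T r y \in T /\ r (first T r y) y.
Proof.
move=> [x xT rxy].
have hr : has (r^~ y) (enum T) by apply/hasP; exists x; rewrite ?mem_enum.
by rewrite -mem_enum mem_nth -?has_find // (nth_find y hr).
Qed.

(* Under the second hypothesis the rank of [first T r y] is monotone along the
   arcs of [A], hence constant along each cycle. *)
Lemma colorable_first (T A : {set D}) (r : rel D) k :
    {in A, forall y, exists2 x, x \in T & r x y} ->
    {in A &, forall y z, arc y z -> r (first T r y) z} \/
    {in A &, forall y z, arc z y -> r (first T r y) z} ->
    {in T, forall x, colorable [set y in A | r x y] k} ->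
  colorable A k.
Proof.
move=> exT step colT; pose m y := find (r^~ y) (enum T).
have le_m y z : y \in A -> z \in A -> r (first T r y) z -> m z <= m y.
  move=> yA zA ryz; rewrite leqNgt; apply/negP=> /(before_find z).
  have hr : m y < size (enum T).
    by rewrite -has_find; apply/hasP; have [x xT rx] := exT _ yA; exists x;
       rewrite ?mem_enum.
  by rewrite (set_nth_default y) // -/(first T r y) ryz.
apply: (colorable_fibers (m := m)) => [|n].
  by case: step => step; [left|right] => y z yA zA yz;
     apply: le_m (step _ _ _ _ yz).
(* The members of a nonempty fiber have the same first vertex in [T], and all are related to it. An
   empty fiber names no such vertex and is treated apart. *)
have [->|[y0]] := set_0Vmem [set x in A | m x == n].
  by exists (fun=> 0); split=> [x|i [|x c] // _ _ /(_ _ (mem_head _ _))];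
     rewrite !inE.
rewrite inE => /andP[y0A /eqP my0].
have [fT _] := firstP (exT _ y0A).
apply: colorableS (leqnn k) (colT _ fT); apply/subsetP=> y; rewrite !inE.
case/andP=> yA /eqP my; rewrite yA /=.
have [_] := firstP (exT _ yA).
rewrite /first -/(m y) -/(m y0) my my0 (set_nth_default y0) //.
rewrite -my -has_find; apply/hasP.
by have [x xT rx] := exT _ yA; exists x; rewrite ?mem_enum.
Qed.

(** * Chords of directed paths with three arcs *)

Hypothesis digon_free : forall x y : D, ~~ (arc x y && arc y x).

Hypothesis K4_free : forall a b c d : D,
  ~~ [&& adj a b, adj a c, adj a d, adj b c, adj b d & adj c d].

Hypothesis dipath3_free : forall a b c d : D,
  arc a b -> arc b c -> arc c d -> [|| adj a c, adj b d | adj a d].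

Definition dicycle3_free S : Prop :=
  {in S & &, forall a b c, ~~ [&& arc a b, arc b c & arc c a]}.

(* A shortest directed cycle on at least five vertices would be induced. *)
Lemma short_cycle S :
    dicycle3_free S ->
    (forall a b c d, a \in S -> b \in S -> c \in S -> d \in S ->
       ~~ [&& arc a b, arc b c, arc c d & arc d a]) ->
  cycle_free S.
Proof.
move=> tfS no4 c; have [n] := ubnP (size c).
elim: n c => // n IHn [|x1 [|x2 [|x3 [|x4 [|x5 c]]]]] //= lt_n cc _ sc.
- by rewrite arc_irr in cc.
- by move: cc; rewrite andbT; apply/negP/digon_free.
- by move: cc; rewrite andbT; apply/negP/tfS; apply: sc; rewrite !inE eqxx ?orbT.
- by move: cc; rewrite andbT; apply/negP/no4; apply: sc; rewrite !inE eqxx ?orbT.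
case/and5P: cc => x12 x23 x34 x45 cc.
have S1 : x1 \in S by apply: sc; rewrite !inE eqxx ?orbT.
have S2 : x2 \in S by apply: sc; rewrite !inE eqxx ?orbT.
have S3 : x3 \in S by apply: sc; rewrite !inE eqxx ?orbT.
have S4 : x4 \in S by apply: sc; rewrite !inE eqxx ?orbT.
(* A forward chord shortens the cycle; a backward one closes a directed triangle or a directed
   4-cycle. *)
case/or3P: (dipath3_free x12 x23 x34) => /orP[] xx.
- apply: (IHn [:: x1, x3, x4, x5 & c]) => //=; first by rewrite xx x34 x45.
  by move=> y yc; apply: sc; move: yc;
     rewrite !inE => /or4P[->|->|->|->]; rewrite ?orbT.
- by have := tfS _ _ _ S1 S2 S3; rewrite x12 x23 xx.
- apply: (IHn [:: x1, x2, x4, x5 & c]) => //=; first by rewrite xx x12 x45.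
  by move=> y yc; apply: sc; move: yc;
     rewrite !inE => /or4P[->|->|->|->]; rewrite ?orbT.
- by have := tfS _ _ _ S2 S3 S4; rewrite x23 x34 xx.
- apply: (IHn [:: x1, x4, x5 & c]) => //=; [by lia|by rewrite xx x45|].
  by move=> y yc; apply: sc; move: yc;
     rewrite !inE => /or3P[->|->|->]; rewrite ?orbT.
by have := no4 _ _ _ _ S1 S2 S3 S4; rewrite x12 x23 x34 xx.
Qed.

(** * Directed triangles *)

(* For a directed triangle [a -> b -> c -> a], the vertices that can replace
   [a]. *)
Definition twins S (b c : D) : {set D} := [set x in S | arc x b && arc c x].

(** Excluding the neighbours of [b] and [c] leaves a path from [c], or to [b], through a twin and
    two such vertices only one possible chord. *)
Definition second_nbr S (b c : D) : {set D} :=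
  [set y in S | [&& ~~ adj b y, ~~ adj c y & [exists x in twins S b c, adj x y]]].

(* Vertices are split according to the direction of the arc joining them to their
   first neighbour among the twins: if [x] is the first neighbour of [y] and
   [arc x y], then for [arc y z] the path [c -> x -> y -> z] forces [adj x z];
   the other direction uses [b]. *)
Lemma colorable_second_nbr S b c s :
    {in S, forall x, colorable (S :&: nbr x) s} ->
  colorable (second_nbr S b c) (s + s).
Proof.
move=> colS; set Y := second_nbr S b c; set T := twins S b c.
have exT y : y \in Y -> exists2 x, x \in T & adj x y.
  rewrite inE => /and4P[_ _ _ /existsP[x /andP[xT xy]]].
  by exists x.
pose A := [set y in Y | arc (first T adj y) y].
have -> : Y = A :|: (Y :\: A).
  by apply/setP=> y; rewrite in_setU in_setD [y \in A]inE;
     case: (y \in Y); rewrite /= ?andbF ?andbT ?orbN.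
have colT (B : {set D}) x :
    B \subset Y -> x \in T -> colorable [set y in B | adj x y] s.
  move=> sBY; rewrite inE => /andP[xS _].
  apply: colorableS (leqnn s) (colS _ xS); apply/subsetP=> y.
  rewrite !inE => /andP[/(subsetP sBY)]; rewrite inE => /andP[-> _] -> //.
have sA : A \subset Y by apply/subsetP=> y; rewrite inE => /andP[].
have sYA : Y :\: A \subset Y by apply: subsetDl.
apply: colorableU; apply: (colorable_first (T := T) (r := adj)).
- by move=> y /(subsetP sA)/exT.
- left=> y z /[dup] yA; rewrite inE => /andP[yY xy] zA yz.
  have [xT _] := firstP (exT _ yY); move: (first T adj y) xT xy => x.
  rewrite inE => /and3P[_ _ cx] xy.
  move: yY (subsetP sA _ zA); rewrite !inE => /and4P[_ _ cy _] /and4P[_ _ cz _].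
  by move: (dipath3_free cx xy yz); rewrite (negPf cy) (negPf cz) orbF.
- by move=> x; apply: colT.
- by move=> y /(subsetP sYA)/exT.
- right=> y z /setDP[yY yNA] /setDP[zY _] zy.
  have [xT xy] := firstP (exT _ yY).
  have {xy yNA}yx : arc y (first T adj y).
    by move: yNA; rewrite inE yY /=; case/orP: xy => ->.
  move: (first T adj y) xT yx => x.
  rewrite inE => /and3P[_ xb _] yx.
  move: yY zY; rewrite !inE => /and4P[_ by_ _ _] /and4P[_ bz _ _].
  move: (dipath3_free zy yx xb).
  by rewrite ![adj _ b]adjC (negPf by_) (negPf bz) !orbF adjC.
- by move=> x; apply: colT.
Qed.

(** A vertex of [Q] with an in-neighbour [u] and an out-neighbour [w] in [S] outside [Q] would have
    to be a twin of a vertex of the triangle, but twins have no neighbours in [S] outside [Q]. *)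
Lemma dipolar_triangle S s a b c :
    {in S, forall x, colorable (S :&: nbr x) s} ->
    a \in S -> b \in S -> c \in S -> arc a b -> arc b c -> arc c a ->
  exists Q, [/\ a \in Q, colorable Q (9 * s) & dipolar S Q].
Proof.
move=> colS aS bS cS ab bc ca.
pose N := S :&: nbr a :|: S :&: nbr b :|: S :&: nbr c.
pose Y := second_nbr S b c :|: second_nbr S c a :|: second_nbr S a b.
exists (N :|: Y); split.
- by rewrite !inE aS [adj b a]adjC (arc_adj ab) ?orbT.
- have -> : 9 * s = (s + s + s) + ((s + s) + (s + s) + (s + s)) by lia.
  by do ![apply: colorableU]; (apply: colS || apply: colorable_second_nbr).
have outP x : x \in S :\: (N :|: Y) ->
    [/\ ~~ adj a x, ~~ adj b x, ~~ adj c x &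
     {in twins S b c :|: twins S c a :|: twins S a b, forall t, ~~ adj t x}].
  rewrite 2!inE negb_or => /andP[/andP[xN xY] xS].
  move: xN; rewrite !inE xS /= 2!negb_or => /andP[/andP[xa xb] xc].
  split=> // t tT; apply: contra xY => tx; rewrite !inE xS xa xb xc /=.
  have ex p q : t \in twins S p q -> [exists z in twins S p q, adj z x].
    by move=> tpq; apply/existsP; exists t; rewrite tpq.
  by case/setUP: tT => [/setUP[]|] /ex->; rewrite ?orbT.
move=> v vQ u w /outP[ua ub uc uT] /outP[wa wb wc wT].
apply/negP=> /andP[uv vw].
have {}vQ : v \in N.
  case/setUP: vQ => // vY; exfalso.
  (* For a twin [t] adjacent to [v], one of the paths [q -> t -> v -> w] and [u -> v -> t -> p]
     would be induced. *)
  have main p q : ~~ adj p u -> ~~ adj q w ->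
      twins S p q \subset twins S b c :|: twins S c a :|: twins S a b ->
      v \notin second_nbr S p q.
    move=> pu qw sT; apply/negP; rewrite inE => /and4P[_ pv qv /existsP[t]].
    case/andP=> tT tv; have tT' := subsetP sT _ tT.
    move: tT; rewrite inE => /and3P[_ tp qt].
    case/orP: tv => tv.
      move: (dipath3_free qt tv vw).
      by rewrite (negPf qv) (negPf qw) (negPf (wT _ tT')).
    move: (dipath3_free uv tv tp).
    by rewrite adjC (negPf (uT _ tT')) ![adj _ p]adjC (negPf pv) (negPf pu).
  case/setUP: vY => [/setUP[]|]; apply/negP; apply: main => //.
  - by rewrite -setUA subsetUl.
  - by rewrite setUAC subsetUr.
  - by rewrite subsetUr.
have vS : v \in S by move: vQ; rewrite !inE -!andb_orr => /andP[].
have fwd p q : ~~ adj p w -> ~~ adj q w -> arc p q -> arc q v -> adj v p.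
  move=> pw qw pq qv; move: (dipath3_free pq qv vw).
  by rewrite (negPf pw) (negPf qw) !orbF adjC.
have bwd p q : ~~ adj p u -> ~~ adj q u -> arc p q -> arc v p -> adj v q.
  move=> pu qu pq vp; move: (dipath3_free uv vp pq).
  by rewrite ![adj u _]adjC (negPf pu) (negPf qu) !orbF.
have vT : v \notin twins S b c :|: twins S c a :|: twins S a b.
  by apply/negP=> /uT; rewrite adjC (arc_adj uv).
move: vT; rewrite !inE vS /= !negb_or => /andP[/andP[Tbc Tca] Tab].
(* Each arc between [v] and the triangle forces a second adjacency, and [K4_free] forbids all three.
   The two that remain must be oriented so that [v] can replace the third vertex, against [vT]. *)
move: (fwd _ _ wa wb ab) (fwd _ _ wb wc bc) (fwd _ _ wc wa ca).
move: (bwd _ _ ua ub ab) (bwd _ _ ub uc bc) (bwd _ _ uc ua ca).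
move: (K4_free v a b c).
rewrite ![adj a _]/adj ![adj b _]/adj ab bc ca !orbT !andbT.
move: vQ Tbc Tca Tab; rewrite !inE vS /= /adj.
case: (arc v a) (arc a v) (arc v b) (arc b v) (arc v c) (arc c v)
  => [] [] [] [] [] [] //=; by move=> *; intuition.
Qed.

(** * Directed 4-cycles in the absence of directed triangles *)

(** Without directed triangles, a forced chord joining the second and fourth, or first and third,
    vertices of a path must point forward, so arcs can be transported along the 4-cycle. *)
Lemma dipolar_square S s a b c d :
    {in S, forall x, colorable (S :&: nbr x) s} -> dicycle3_free S ->
    a \in S -> b \in S -> c \in S -> d \in S ->
    arc a b -> arc b c -> arc c d -> arc d a ->
  exists Q, [/\ a \in Q, colorable Q (9 * s) & dipolar S Q].
Proof.
move=> colS tfS aS bS cS dS ab bc cd da.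
pose N := S :&: nbr a :|: S :&: nbr b :|: S :&: nbr c :|: S :&: nbr d.
pose O := [set y in S | ~~ adj a y && [exists x in S, arc a x && arc x y]].
pose I := [set y in S | ~~ adj a y && [exists x in S, arc x a && arc y x]].
have tf x y z : x \in S -> y \in S -> z \in S ->
    arc x y -> arc y z -> arc z x = false.
  move=> xS yS zS xy yz; apply/negP=> zx.
  by move: (tfS _ _ _ xS yS zS); rewrite xy yz zx.
(* On [a -> x -> y -> z] with [y] and [z] in [O] the only possible chord is [x -> z], so the rank of
   the first in-neighbour is monotone. The set [I] is symmetric. *)
have colO : colorable O s.
  apply: (colorable_first (T := [set x in S | arc a x]) (r := @arc D)).
  - move=> y; rewrite inE => /and3P[_ _ /existsP[x /and3P[xS ax xy]]].
    by exists x; rewrite // inE xS.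
  - left=> y z yO zO yz; have := yO; rewrite inE => /and3P[yS ay /existsP[x]].
    case/and3P=> xS ax xy.
    have [|] := @firstP [set x in S | arc a x] (@arc D) y.
      by exists x; rewrite // inE xS.
    move: (first _ _ _) => {xS ax xy}x; rewrite inE => /andP[xS ax] xy.
    move: zO; rewrite inE => /and3P[zS az _].
    move: (dipath3_free ax xy yz); rewrite (negPf ay) (negPf az) orbF /adj.
    by rewrite (tf x y z) // orbF.
  - move=> x; rewrite inE => /andP[xS _].
    apply: colorableS (leqnn s) (colS _ xS); apply/subsetP=> y.
    by rewrite !inE /adj => /andP[/andP[-> _] ->].
have colI : colorable I s.
  apply: (colorable_first (T := [set x in S | arc x a])
                          (r := fun x y => arc y x)).
  - move=> y; rewrite inE => /and3P[_ _ /existsP[x /and3P[xS ax xy]]].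
    by exists x; rewrite // inE xS.
  - right=> y z yO zO zy; have := yO; rewrite inE => /and3P[yS ay /existsP[x]].
    case/and3P=> xS xa yx.
    have [|] := @firstP [set x in S | arc x a] (fun x y => arc y x) y.
      by exists x; rewrite // inE xS.
    move: (first _ _ _) => {xS xa yx}x; rewrite inE => /andP[xS xa] yx.
    move: zO; rewrite inE => /and3P[zS az _].
    move: (dipath3_free zy yx xa).
    rewrite ![adj _ a]adjC (negPf ay) (negPf az) !orbF /adj.
    by rewrite (tf z y x) // orbF.
  - move=> x; rewrite inE => /andP[xS _].
    apply: colorableS (leqnn s) (colS _ xS); apply/subsetP=> y.
    by rewrite !inE /adj => /andP[/andP[-> _] ->]; rewrite orbT.
exists (N :|: (O :|: I)); split.
- by rewrite !inE aS [adj b a]adjC (arc_adj ab) ?orbT.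
(* Only [6 * s] colors are used; the count is relaxed to match the triangle case. *)
- apply: (@colorableS _ _ (s + s + s + s + (s + s)) _ (subxx _)); first by lia.
  by do ![apply: colorableU] => //; apply: colS.
have outP x : x \in S :\: (N :|: (O :|: I)) ->
    [/\ x \in S, [/\ ~~ adj a x, ~~ adj b x, ~~ adj c x & ~~ adj d x],
        {in S, forall t, arc a t -> ~~ arc t x} &
        {in S, forall t, arc t a -> ~~ arc x t}].
  rewrite in_setD in_setU (in_setU x O) 2!negb_or.
  case/andP=> /and3P[xN xO xI] xS.
  move: xN; rewrite !inE xS /= 3!negb_or => /andP[/andP[/andP[xa xb] xc] xd].
  split=> // t tS at_; apply/negP=> tx.
    by case/negP: xO; rewrite inE xS xa; apply/existsP; exists t; rewrite tS at_.
  by case/negP: xI; rewrite inE xS xa; apply/existsP; exists t; rewrite tS at_.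
move=> v vQ u w /outP[uS [ua ub uc ud] _ uI] /outP[wS [wa wb wc wd] wO _].
apply/negP=> /andP[uv vw].
case/setUP: vQ => [vN|/setUP[]]; last 2 first.
- rewrite inE => /and3P[vS av /existsP[x /and3P[xS ax xv]]].
  move: (dipath3_free ax xv vw); rewrite (negPf av) (negPf wa) orbF /adj.
  by rewrite (tf x v w) // (negPf (wO _ xS ax)).
- rewrite inE => /and3P[vS av /existsP[x /and3P[xS xa vx]]].
  move: (dipath3_free uv vx xa).
  rewrite ![adj _ a]adjC (negPf av) (negPf ua) !orbF /adj.
  by rewrite (tf u v x) // (negPf (uI _ xS xa)).
have vS : v \in S by move: vN; rewrite !inE -!andb_orr => /andP[].
have fwd p q : p \in S -> q \in S -> ~~ adj p w -> ~~ adj q w ->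
    arc p q -> arc q v -> arc p v.
  move=> pS qS pw qw pq qv; move: (dipath3_free pq qv vw).
  by rewrite (negPf pw) (negPf qw) !orbF /adj (tf p q v) // orbF.
have bwd p q : p \in S -> q \in S -> ~~ adj p u -> ~~ adj q u ->
    arc p q -> arc v p -> arc v q.
  move=> pS qS pu qu pq vp; move: (dipath3_free uv vp pq).
  by rewrite ![adj u _]adjC (negPf pu) (negPf qu) !orbF /adj (tf v p q) // orbF.
(* Arcs between [v] and [a] are excluded by [O] and [I]. An arc from [v] to the 4-cycle is carried
   on to [a] by [bwd], and an arc into [v] is carried back to [a] by [fwd]; so [v] has no neighbour
   on the 4-cycle. *)
have av : ~~ arc a v by apply/negP=> av; move: (wO _ vS av); rewrite vw.
have va : ~~ arc v a by apply/negP=> va; move: (uI _ vS va); rewrite uv.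
have dv : ~~ arc v d by apply: contra va; apply: bwd.
have cv : ~~ arc v c by apply: contra dv; apply: bwd.
have bv : ~~ arc v b by apply: contra cv; apply: bwd.
have vb : ~~ arc b v by apply: contra av; apply: fwd.
have vc : ~~ arc c v by apply: contra vb; apply: fwd.
have vd : ~~ arc d v by apply: contra vc; apply: fwd.
by move: vN; rewrite !inE vS /adj (negPf av) (negPf va) (negPf bv) (negPf vb)
  (negPf cv) (negPf vc) (negPf dv) (negPf vd).
Qed.

(** * From neighbourhoods to the whole digraph *)

(** Removing a dipolar set that is [9 * s]-colorable costs no new color, since the rest may use all
    [18 * s]; induction on the size of [S] then ends at a set with no directed triangle or
    4-cycle. *)
Lemma colorable_local S s :
    0 < s -> {in S, forall x, colorable (S :&: nbr x) s} ->
  colorable S (18 * s).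
Proof.
move=> s0; have [n] := ubnP #|S|; elim: n S => // n IHn S lt_n colS.
have step a Q : a \in S -> a \in Q -> colorable Q (9 * s) -> dipolar S Q ->
    colorable S (18 * s).
  move=> aS aQ colQ dipQ; have -> : 18 * s = (9 * s).*2 by lia.
  apply: colorable_dipolar dipQ colQ _; have -> : (9 * s).*2 = 18 * s by lia.
  apply: IHn => [|x]; last first.
    rewrite inE => /andP[_ xS].
    by apply: colorableS (leqnn s) (colS _ xS); rewrite setSI ?subsetDl.
  rewrite ltnS in lt_n; apply: leq_trans lt_n; apply: proper_card.
  by apply/properP; split; [apply: subsetDl|exists a; rewrite ?inE ?aQ].
have [[[a b] c] /=|no3] := pickP (fun t : D * D * D =>
    [&& t.1.1 \in S, t.1.2 \in S, t.2 \in S,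
        arc t.1.1 t.1.2, arc t.1.2 t.2 & arc t.2 t.1.1]).
  case/and5P=> aS bS cS ab /andP[bc ca].
  by have [Q [aQ colQ dipQ]] := dipolar_triangle colS aS bS cS ab bc ca;
     apply: step aQ _ _.
have tfS : dicycle3_free S.
  by move=> a b c aS bS cS; have := no3 (a, b, c); rewrite /= aS bS cS /= => ->.
have [[[[a b] c] d] /=|no4] := pickP (fun t : D * D * D * D =>
    [&& t.1.1.1 \in S, t.1.1.2 \in S, t.1.2 \in S, t.2 \in S,
        arc t.1.1.1 t.1.1.2, arc t.1.1.2 t.1.2, arc t.1.2 t.2 & arc t.2 t.1.1.1]).
  case/and5P=> aS bS cS dS /and4P[ab bc cd da].
  by have [Q [aQ colQ dipQ]] := dipolar_square colS tfS aS bS cS dS ab bc cd da;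
     apply: step aQ _ _.
apply: colorable_cycle_free; first by lia.
apply: short_cycle => // a b c d aS bS cS dS.
by have := no4 (a, b, c, d); rewrite /= aS bS cS dS /= => ->.
Qed.

Lemma colorable_setT : colorable [set: D] 324.
Proof.
(* Two nested uses give [18 * 18 * 1]: one on the whole digraph, one inside the neighbourhood of
   [v], where neighbourhoods are stable. *)
apply: (colorable_local (s := 18)) => // v _; rewrite setTI.
apply: (colorable_local (s := 1)) => // u uv.
apply: colorable_cycle_free => //; apply: stable_cycle_free => x y.
rewrite !inE => /andP[vx ux] /andP[vy uy]; apply/negP=> xy.
move: uv (K4_free v u x y); rewrite inE => ->.
by rewrite vx ux vy uy (arc_adj xy).
Qed.

End Coloring.

(** * The dichromatic number and forbidden induced subdigraphs *)

Lemma dichromatic_colorable (D : digraph) k :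
  colorable [set: D] k -> dichromatic D <= k.
Proof.
move=> [f [ltf cff]]; rewrite /dichromatic; case: ex_minnP => n _; apply.
have ltf' x : f x < k by apply: ltf.
apply/existsP; exists [ffun x => Ordinal (ltf' x)].
apply/forallP=> i; apply/acyclicP=> c /and3P[lt1 cc _] sc.
apply: (cff i c cc) => [|x /sc]; first by case: c lt1 {cc sc}.
by rewrite !inE ffunE.
Qed.

Theorem theorem11 (D : digraph) :
  Forb_ind (fun H => H = inl digon \/ H = inr (complete 4) \/ H = inl (dipath 3)) D ->
  dichromatic D <= 414.
Proof.
move=> forbD.
have digonF x y : ~~ (arc x y && @arc D y x).
  apply/negP=> /andP[xy yx]; apply: (forbD (inl digon)); first by left.
  pose f (i : 'I_2) := nth x [:: x; y] i.
  have fE i j : arc (f i) (f j) = (i != j).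
    rewrite /f -val_eqE; case: i j => [[|[|//]] i_lt] [[|[|//]] j_lt] /=;
      by rewrite ?arc_irr ?xy ?yx.
  exists f => // i j fij; apply: contraTeq isT; rewrite -fE fij.
  by rewrite arc_irr.
apply: dichromatic_colorable.
(* The construction gives 324 colors, which is below the required 414. *)
apply: (@colorableS D setT setT 324) => //; apply: colorable_setT => //.
- move=> a b c d; apply/negP=> K.
  pose f (i : 'I_4) := nth a [:: a; b; c; d] i.
  have fE i j : i != j -> adj (f i) (f j).
    case/and5P: K => ab ac ad bc /andP[bd cd]; rewrite /f -val_eqE.
    case: i j => [[|[|[|[|//]]]] i_lt] [[|[|[|[|//]]]] j_lt] //= _;
      by rewrite // adjC.
  apply: (forbD (inr (complete 4)) _ (fun i j => arc (f i) (f j))).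
  + by right; left.
  + split=> [i j|i j]; first exact: digonF.
    rewrite -/(adj (f i) (f j)) /=; case: eqVneq => [->|/fE-> //].
    by rewrite /adj arc_irr.
  exists f => // i j fij; apply: contraTeq isT => /fE.
  by rewrite fij /adj arc_irr.
move=> a b c d ab bc cd; apply: contraT; rewrite !negb_or.
case/and3P=> /andP[ac ca] /andP[bd db] /andP[ad da].
case: (forbD (inl (dipath 3))); first by right; right.
have ba : arc b a = false by move: (digonF a b); rewrite ab => /negPf.
have cb : arc c b = false by move: (digonF b c); rewrite bc => /negPf.
have dc : arc d c = false by move: (digonF c d); rewrite cd => /negPf.
pose f (i : 'I_4) := nth a [:: a; b; c; d] i.
have fE i j : arc (f i) (f j) = (j == i.+1 :> nat).
  rewrite /f; case: i j => [[|[|[|[|//]]]] i_lt] [[|[|[|[|//]]]] j_lt] /=;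
    by rewrite ?arc_irr // ?(negPf ac) ?(negPf ca) ?(negPf bd) ?(negPf db)
      ?(negPf ad) ?(negPf da).
exists f => // i j fij; apply/val_inj.
(* Injectivity is read off the arcs: an index below 3 is determined by its successor, and index 3 is
   the only out-neighbour of index 2. *)
have [i_lt|i_ge] := ltnP i 3.
  have := fE i (Ordinal (i_lt : i.+1 < 4)).
  by rewrite fij fE /= eqxx => /eqP[].
have -> : val i = 3 by have := ltn_ord i; rewrite /=; lia.
have := fE (Ordinal (isT : 2 < 4)) i.
by rewrite fij fE /= => /esym; case: eqP => //; have := ltn_ord i; lia.
Qed.
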